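(* Let $(\mathcal{X},d_{\mathcal{X}})$ and $(\mathcal{Y},d_{\mathcal{Y}})$ be separable metric spaces, both consisting of two or more points. If at least one of these metric spaces is not of strong negative type, then there exists a measure $\theta\in M_1^{1,1}(\mathcal{X}\times\mathcal{Y})$ with marginals $\mu\in M_1^1(\mathcal{X})$ and $\nu\in M_1^1(\mathcal{Y})$ such that $dcov(\theta)=0$ but $\theta\neq\mu\times\nu$.
   Context: A metric space is of negative type if $\sum_{i,j=1}^n\alpha_i\alpha_j d(x_i,x_j)\le 0$ for all $n\in\mathbb{N}$, points $x_1,\dots,x_n$ and $\alpha\in\mathbb{R}^n$ with $\sum_i\alpha_i=0$. $M_1^1(\mathcal{X})$ is the set of Borel probability measures $\mu$ on $\mathcal{X}$ with finite first moment: $\int d_{\mathcal{X}}(x,o)\,d\mu(x)<\infty$ for some (equivalently every) $o\in\mathcal{X}$. $M^1(\mathcal{X})$ is the set of finite signed Borel measures $\mu$ with $\int d_{\mathcal{X}}(x,o)\,d|\mu|(x)<\infty$. $M_1^{1,1}(\mathcal{X}\times\mathcal{Y})$ is the set of probability measures on $\mathcal{B}(\mathcal{X})\otimes\mathcal{B}(\mathcal{Y})$ whose marginals lie in $M_1^1(\mathcal{X})$ and $M_1^1(\mathcal{Y})$. For $\mu\in M^1(\mathcal{X})$: $a_\mu(x)=\int d_{\mathcal{X}}(x,y)\,d\mu(y)$, $D(\mu)=\int a_\mu\,d\mu=\int d_{\mathcal{X}}\,d(\mu\times\mu)$, $d_\mu(x_1,x_2)=d_{\mathcal{X}}(x_1,x_2)-a_\mu(x_1)-a_\mu(x_2)+D(\mu)$,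 and analogously on $\mathcal{Y}$. A metric space $(\mathcal{X},d_{\mathcal{X}})$ is of strong negative type if it is of negative type and for all $\mu_1,\mu_2\in M_1^1(\mathcal{X})$: $D(\mu_1-\mu_2)=0\iff\mu_1=\mu_2$. For $\theta\in M_1^{1,1}(\mathcal{X}\times\mathcal{Y})$ with marginals $\mu,\nu$, $$dcov(\theta)=\int d_\mu(x_1,x_2)\,d_\nu(y_1,y_2)\,d(\theta\times\theta)((x_1,y_1),(x_2,y_2)).$$ *)

(* Defs.v *)
From HB Require Import structures.
From mathcomp Require Import all_boot all_order all_algebra.
From mathcomp Require Import all_classical all_reals all_analysis.

Set Implicit Arguments.
Unset Strict Implicit.
Unset Printing Implicit Defensive.

Import Order.TTheory GRing.Theory Num.Theory.
Import numFieldNormedType.Exports.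

Local Open Scope classical_set_scope.
Local Open Scope ring_scope.

(* The library's measurable types are pointed; the base point plays no role
   besides making [g_sigma_algebraType] applicable to a nonempty space. *)
#[short(type="pointedMetricType")]
HB.structure Definition PointedMetric (R : numDomainType) :=
  {T of Metric R T & Pointed T}.

Section metric_space.
Context {R : realType}.

Definition separable_space (X : topologicalType) :=
  exists2 A : set X, countable A & dense A.

Definition negative_type (X : metricType R) :=
  forall (n : nat) (x : 'I_n -> X) (alpha : 'I_n -> R),
    \sum_(i < n) alpha i = 0 ->
    \sum_(i < n) \sum_(j < n) alpha i * alpha j * mdist (x i) (x j) <= 0.

End metric_space.

Notation borel X := (g_sigma_algebraType (@open X)).

HB.instance Definition _ d1 d2 (T1 : measurableType d1)
    (T2 : measurableType d2) :=
  isMeasurableFun.Build _ _ (T1 * T2)%type T1 fst measurable_fst.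

HB.instance Definition _ d1 d2 (T1 : measurableType d1)
    (T2 : measurableType d2) :=
  isMeasurableFun.Build _ _ (T1 * T2)%type T2 snd measurable_snd.

Section signed_integral.
Context {d : measure_display} {T : measurableType d} {R : realType}.
Variable nu : {charge set T -> \bar R}.

Definition hahn_pos : set T := sval (cid (Hahn_decomposition nu)).

Definition hahn_neg : set T := sval (cid (svalP (cid (Hahn_decomposition nu)))).

Lemma hahnP : hahn_decomposition nu hahn_pos hahn_neg.
Proof. exact: svalP (cid (svalP (cid (Hahn_decomposition nu)))). Qed.

(* The chosen Hahn decomposition is immaterial: the Jordan decomposition of
   [nu] does not depend on it. *)
Definition signed_Rintegral (f : T -> R) : R :=
  Rintegral (jordan_pos hahnP) setT f - Rintegral (jordan_neg hahnP) setT f.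

End signed_integral.

Section distance_covariance.
Context {R : realType}.
Implicit Types X Y : pointedMetricType R.

Definition finite_first_moment X (mu : probability (borel X) R) :=
  exists o : X, (\int[mu]_x (@mdist R X x o)%:E < +oo)%E.

(* [amean mu], [Dmean mu] and [dcentered mu] are a_mu, D(mu) and d_mu for a
   finite signed measure mu; probabilities enter through
   [charge_of_finite_measure]. *)
Definition amean X (mu : {charge set (borel X) -> \bar R}) (x : X) : R :=
  signed_Rintegral mu (@mdist R X x).

Definition Dmean X (mu : {charge set (borel X) -> \bar R}) : R :=
  signed_Rintegral mu (amean mu).

Definition dcentered X (mu : {charge set (borel X) -> \bar R}) (x1 x2 : X) : R :=
  mdist x1 x2 - amean mu x1 - amean mu x2 + Dmean mu.

Definition charge_sub X (mu1 mu2 : probability (borel X) R) :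
    {charge set (borel X) -> \bar R} :=
  cadd (charge_of_finite_measure mu1) (copp (charge_of_finite_measure mu2)).

(* Measures are compared on measurable sets only: the values of a measure of
   the library outside the sigma-algebra are unspecified. *)
Definition same_measure (d : measure_display) (T : measurableType d)
    (mu1 mu2 : set T -> \bar R) :=
  forall A : set T, measurable A -> mu1 A = mu2 A.

Definition strong_negative_type X :=
  negative_type X /\
  forall mu1 mu2 : probability (borel X) R,
    finite_first_moment mu1 -> finite_first_moment mu2 ->
    (Dmean (charge_sub mu1 mu2) = 0 <-> same_measure mu1 mu2).

Definition marginal1 X Y (theta : probability (borel X * borel Y)%type R) :
    probability (borel X) R :=
  distribution theta (@fst (borel X) (borel Y)).

Definition marginal2 X Y (theta : probability (borel X * borel Y)%type R) :
    probability (borel Y) R :=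
  distribution theta (@snd (borel X) (borel Y)).

Definition finite_first_moments X Y
    (theta : probability (borel X * borel Y)%type R) :=
  finite_first_moment (marginal1 theta) /\ finite_first_moment (marginal2 theta).

(* Extended-real valued, so that [dcov theta = 0] does not rely on the
   convention [fine +oo = 0]. *)
Definition dcov X Y (theta : probability (borel X * borel Y)%type R) : \bar R :=
  (\int[theta \x theta]_z
    (dcentered (charge_of_finite_measure (marginal1 theta)) z.1.1 z.2.1 *
     dcentered (charge_of_finite_measure (marginal2 theta)) z.1.2 z.2.2)%:E)%E.

End distance_covariance.

(* Main.v *)
Require Import Defs.
From HB Require Import structures.
From mathcomp Require Import all_boot all_order all_algebra.
From mathcomp Require Import all_classical all_reals all_analysis.
From mathcomp Require Import measurable_realfun ring lra.

Set Implicit Arguments.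
Unset Strict Implicit.
Unset Printing Implicit Defensive.

Import Order.TTheory GRing.Theory Num.Theory.
Import numFieldNormedType.Exports.

Local Open Scope classical_set_scope.
Local Open Scope ring_scope.

(** For probability measures with finite first moment write E(mu, nu) for the
    integral of the distance against mu x nu ([energy]) and
    Q(mu, nu) = E(mu, mu) - 2 E(mu, nu) + E(nu, nu) ([energy_gap]), which is
    D(mu - nu).

    The measure theta is the half-half mixture of two products mu1 x nu1 and
    mu2 x nu2.  Its marginals are the midpoints mu = (mu1 + mu2) / 2 and
    nu = (nu1 + nu2) / 2, and theta - mu x nu = (mu1 - mu2) x (nu1 - nu2) / 4.
    Hence theta is a product if and only if mu1 = mu2 or nu1 = nu2, while
    dcov(theta) = Q(mu1, mu2) Q(nu1, nu2) / 16 ([dcov_half_mixture]).  The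
    formula is symmetric in the two spaces, so it is enough to find, in the
    space that is not of strong negative type, two distinct measures with
    Q = 0; two Dirac masses at distinct points do on the other side.

    Such a pair is given by [not_strong_negative_type_zero_gap].  If the space
    is of negative type, the failure of strong negative type is exactly the
    existence of the pair, once D(mu1 - mu2), defined through a Jordan
    decomposition, is known to be Q(mu1, mu2) ([Dmean_charge_sub]).  If it is
    not of negative type, the positive and negative parts of a bad coefficient
    vector, normalized, are discrete measures with Q > 0
    ([exists_positive_energy_gap]).  Two distinct points a and b give
    Q = - 2 d(a, b) < 0, and moving linearly from the first pair to
    (delta_a, delta_b) one meets a pair with Q = 0; its two members differ,
    since otherwise the two signed measures at the ends of the segment would
    be proportional and Q would have the same sign on both
    ([exists_zero_energy_gap]).

    The measure theory rests on one device.  Each kernel k(x, y) integrated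
    here, namely the distance, the centered distances and the product of two
    centered distances, is bounded by a product u(x) v(y) of integrable
    functions of one variable, so that Fubini applies and the double integral
    is bilinear in the two measures ([pairing_swap], [pairing_mixture]).
    Separability is what makes the distance measurable for the product of the
    Borel sigma-algebras ([measurable_mdist]). *)

(** * Mixtures of measures *)

Local Notation rintegrable mu f := (mu.-integrable [set: _] (EFin \o f)).

Section mixtures.
Context d (T : measurableType d) (R : realType).
Implicit Types (f : T -> R).

(** A relation rather than a construction: marginals of mixtures satisfy it
    without being built as weighted sums, and it constrains measurable sets
    only. *)
Definition is_mixture n (w : 'I_n -> R) (P : 'I_n -> {measure set T -> \bar R})
    (Q : set T -> \bar R) :=
  forall A, measurable A -> Q A = (\sum_(k < n) (w k)%:E * P k A)%E.

Lemma EFin_Rintegral (m : {measure set T -> \bar R}) f :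
  rintegrable m f -> (Rintegral m setT f)%:E = (\int[m]_x (f x)%:E)%E.
Proof. by move=> fi; rewrite fineK// integrable_fin_num. Qed.

(** Integrals of nonnegative functions against a mixture come from an actual
    weighted sum of measures, which takes the same values as [Q]; integrable
    functions then follow by splitting into positive and negative parts. *)
Section weighted_sum.
Variables (n : nat) (w : 'I_n -> R) (P : 'I_n -> {measure set T -> \bar R}).
Hypothesis w0 : forall k, 0 <= w k.

Let m (k : nat) : {measure set T -> \bar R} :=
  if insub k is Some i then mscale (NngNum (w0 i)) (P i) else mzero.

Let mE (k : 'I_n) : m k = mscale (NngNum (w0 k)) (P k).
Proof. by rewrite /m valK. Qed.

Lemma weighted_sum_is_mixture : is_mixture w P (msum m n).
Proof. by move=> A mA; apply: eq_bigr => k _; rewrite mE. Qed.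

Variable Q : {measure set T -> \bar R}.
Hypothesis QP : is_mixture w P Q.

Lemma ge0_integral_mixture (f : T -> \bar R) :
  measurable_fun setT f -> (forall x, 0 <= f x)%E ->
  (\int[Q]_x f x = \sum_(k < n) (w k)%:E * \int[P k]_x f x)%E.
Proof.
move=> mf f0; rewrite (@eq_measure_integral _ _ _ _ (msum m n)); last first.
  by move=> A mA _; rewrite [LHS](QP mA) [RHS]weighted_sum_is_mixture.
rewrite ge0_integral_measure_sum//; apply: eq_bigr => k _.
by rewrite mE ge0_integral_mscale.
Qed.

Lemma rintegrable_mixture f :
  (forall k, rintegrable (P k) f) -> measurable_fun setT f -> rintegrable Q f.
Proof.
move=> fi mf; apply/integrableP; split; first exact/measurable_EFinP.
rewrite ge0_integral_mixture//; last first.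
  by apply/measurable_EFinP; exact: measurableT_comp.
apply: lte_sum_pinfty => k _; rewrite lte_mul_pinfty// ?lee_fin//.
by case/integrableP: (fi k).
Qed.

Lemma Rintegral_mixture f :
  (forall k, rintegrable (P k) f) -> measurable_fun setT f ->
  Rintegral Q setT f = \sum_(k < n) w k * Rintegral (P k) setT f.
Proof.
move=> fi mf; apply: EFin_inj; rewrite EFin_Rintegral; last first.
  exact: rintegrable_mixture.
have mfE : measurable_fun setT (EFin \o f) by exact/measurable_EFinP.
rewrite integralE ge0_integral_mixture//; last exact: measurable_funepos.
rewrite ge0_integral_mixture//; last exact: measurable_funeneg.
rewrite -sumeN; last first.
  move=> i j _ _; apply: fin_num_adde_defl.
  by rewrite fin_numM// integrable_neg_fin_num.
rewrite -big_split/= -sumEFin; apply: eq_bigr => k _.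
rewrite -muleBr//; last first.
  by rewrite fin_num_adde_defl// fin_numN integrable_neg_fin_num.
by rewrite -[X in (_ * X)%E]integralE -EFin_Rintegral// EFinM.
Qed.

End weighted_sum.

Lemma mixture_exists n (w : 'I_n -> R) (P : 'I_n -> probability T R) :
  (forall k, 0 <= w k) -> \sum_(k < n) w k = 1 ->
  exists Q : probability T R, is_mixture w P Q.
Proof.
move=> w0 w1.
have [m mE] : exists m : {measure set T -> \bar R}, is_mixture w P m.
  by eexists; exact: weighted_sum_is_mixture w0.
have m1 : m setT = 1%E.
  rewrite (mE _ measurableT) (eq_bigr (fun k => (w k)%:E)).
    by rewrite sumEFin w1.
  by move=> k _; rewrite [X in (_ * X)%E](probability_setT (P k)) mule1.
(* The mass of [m] is 1, so that normalizing does not change it; this only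
   serves to see [m] as a probability. *)
exists (mnormalize m (point : probability T R)) => A mA.
by rewrite /= /mnormalize m1 onee_eq0/= invr1 mule1 -mE.
Qed.

Definition binary (A : Type) (a b : A) (i : 'I_2) : A :=
  if i == ord0 then a else b.

Definition is_mix2 (t : R) (mu nu : probability T R) (rho : set T -> \bar R) :=
  is_mixture (binary (1 - t) t) (fun i => binary mu nu i) rho.

Lemma mix2_exists (t : R) (mu nu : probability T R) : 0 <= t <= 1 ->
  exists rho : probability T R, is_mix2 t mu nu rho.
Proof.
move=> /andP[t0 t1]; apply: mixture_exists.
  by move=> i; rewrite /binary; case: ifP; rewrite ?subr_ge0.
by rewrite !big_ord_recl big_ord0 /binary/=; ring.
Qed.

End mixtures.

(** * Dominated kernels *)

Definition pairing (R : realType) d1 d2 (T1 : measurableType d1)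
    (T2 : measurableType d2) (k : T1 -> T2 -> R)
    (mu : {measure set T1 -> \bar R}) (nu : {measure set T2 -> \bar R}) : R :=
  Rintegral mu setT (fun x => Rintegral nu setT (k x)).

Section dominated_kernels.
Context d1 d2 (T1 : measurableType d1) (T2 : measurableType d2) (R : realType).

Lemma rintegrable_le d (T : measurableType d) (mu : {measure set T -> \bar R})
    (f g : T -> R) : measurable_fun setT f -> (forall x, `|f x| <= `|g x|) ->
  rintegrable mu g -> rintegrable mu f.
Proof.
move=> mf fg; apply: le_integrable => //; first exact/measurable_EFinP.
by move=> x _; rewrite /= lee_fin.
Qed.

Lemma rintegrable_measurable d (T : measurableType d)
    (mu : {measure set T -> \bar R}) (f : T -> R) :
  rintegrable mu f -> measurable_fun setT f.
Proof. by move=> /measurable_int/measurable_EFinP. Qed.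

Variables (mu : probability T1 R) (nu : probability T2 R).

Lemma rintegrable_prod (f : T1 -> R) (g : T2 -> R) :
  rintegrable mu f -> rintegrable nu g ->
  rintegrable (mu \x nu)%E (fun z => f z.1 * g z.2).
Proof.
move=> fi gi; have mf := rintegrable_measurable fi.
have mg := rintegrable_measurable gi.
apply/integrable12ltyP.
  apply/measurable_EFinP; apply: measurable_funM.
    exact: (measurableT_comp mf measurable_fst).
  exact: (measurableT_comp mg measurable_snd).
have /integrableP[_ fy] := fi; have /integrableP[_ gy] := gi.
under eq_integral => x _.
  under eq_integral => y _ do rewrite /= normrM EFinM.
  rewrite ge0_integralZl//; last first.
    by apply/measurable_EFinP; exact: measurableT_comp.
  over.
rewrite ge0_integralZr//; last 2 first.
  by apply/measurable_EFinP; exact: measurableT_comp.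
  by apply: integral_ge0.
by rewrite lte_mul_pinfty// ?integral_ge0// ge0_fin_numE ?integral_ge0.
Qed.

(** The bound holds everywhere and not only almost everywhere; therefore every
    section of [k] is integrable, and inner integrals are finite at each
    point. *)
Variables (k : T1 -> T2 -> R) (u : T1 -> R) (v : T2 -> R).
Hypothesis mk : measurable_fun setT (fun z : T1 * T2 => k z.1 z.2).
Hypothesis k_le : forall x y, `|k x y| <= u x * v y.
Hypothesis ui : rintegrable mu u.
Hypothesis vi : rintegrable nu v.

Lemma rintegrable_kernel : rintegrable (mu \x nu)%E (fun z => k z.1 z.2).
Proof.
apply: (rintegrable_le mk) (rintegrable_prod ui vi) => -[x y] /=.
by rewrite (le_trans (k_le x y))// ler_norm.
Qed.

Lemma rintegrable_section x : rintegrable nu (k x).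
Proof.
apply: (@rintegrable_le _ _ _ _ (fun y => u x * v y)).
- exact: (measurableT_comp mk (measurable_pair1 x)).
- by move=> y; rewrite (le_trans (k_le x y))// ler_norm.
- rewrite (_ : _ \o _ = fun y => ((u x)%:E * (v y)%:E)%E)//.
  exact: integrableZl.
Qed.

Let kF : (fun x => \int[nu]_y (k x y)%:E)%E =
         EFin \o (fun x => Rintegral nu setT (k x)).
Proof.
by apply/funext => x /=; rewrite EFin_Rintegral//; exact: rintegrable_section.
Qed.

Lemma rintegrable_inner : rintegrable mu (fun x => Rintegral nu setT (k x)).
Proof. by rewrite -kF; exact: (integrable_fubini_F rintegrable_kernel). Qed.

Lemma EFin_pairing : (pairing k mu nu)%:E = (\int[mu \x nu]_z (k z.1 z.2)%:E)%E.
Proof.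
rewrite -(integral12_prod_meas1 rintegrable_kernel) EFin_Rintegral//.
  apply: eq_integral => x _ /=.
  by rewrite -[RHS]/((fun x => \int[nu]_y (k x y)%:E)%E x) kF.
exact: rintegrable_inner.
Qed.

End dominated_kernels.

Section pairing_swap.
Context d1 d2 (T1 : measurableType d1) (T2 : measurableType d2) (R : realType).
Variables (mu : probability T1 R) (nu : probability T2 R).
Variables (k : T1 -> T2 -> R) (u : T1 -> R) (v : T2 -> R).
Hypothesis mk : measurable_fun setT (fun z : T1 * T2 => k z.1 z.2).
Hypothesis k_le : forall x y, `|k x y| <= u x * v y.
Hypothesis ui : rintegrable mu u.
Hypothesis vi : rintegrable nu v.

Lemma pairing_swap : pairing k mu nu = pairing (fun y x => k x y) nu mu.
Proof.
have mk' : measurable_fun setT (fun z : T2 * T1 => k z.2 z.1).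
  exact: (measurableT_comp mk (@measurable_swap _ _ T2 T1)).
have k_le' y x : `|k x y| <= v y * u x by rewrite mulrC.
apply: EFin_inj; rewrite (EFin_pairing mk k_le ui vi).
rewrite -(integral21_prod_meas1 (rintegrable_kernel mk k_le ui vi)).
rewrite EFin_Rintegral; last exact: (rintegrable_inner mk' k_le' vi ui).
apply: eq_integral => y _; rewrite EFin_Rintegral//.
exact: (rintegrable_section mk' k_le' ui).
Qed.

End pairing_swap.

Lemma Rintegral_prod d1 d2 (T1 : measurableType d1) (T2 : measurableType d2)
    (R : realType) (mu : probability T1 R) (nu : probability T2 R)
    (f : T1 -> R) (g : T2 -> R) : rintegrable mu f -> rintegrable nu g ->
  Rintegral (mu \x nu)%E setT (fun z => f z.1 * g z.2) =
  Rintegral mu setT f * Rintegral nu setT g.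
Proof.
move=> fi gi; have mf := rintegrable_measurable fi.
have mg := rintegrable_measurable gi.
have fgi := rintegrable_prod fi gi.
have absi d (T : measurableType d) (m : probability T R) h :
    rintegrable m h -> rintegrable m (fun x => `|h x|).
  move=> hi; apply: (rintegrable_le _ _ hi) => [|x]; last by rewrite normr_id.
  by apply: measurableT_comp => //; exact: rintegrable_measurable hi.
have fg_le x y : `|f x * g y| <= `|f x| * `|g y| by rewrite normrM.
have mfg := rintegrable_measurable fgi.
rewrite [LHS]/Rintegral.
rewrite -(EFin_pairing mfg fg_le (absi _ _ _ _ fi) (absi _ _ _ _ gi)).
rewrite /= /pairing.
under eq_Rintegral => x _ do rewrite RintegralZl//.
by rewrite RintegralZr.
Qed.

Section pairing_mixtures.
Context d1 d2 (T1 : measurableType d1) (T2 : measurableType d2) (R : realType).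
Variables (k : T1 -> T2 -> R) (u : T1 -> R) (v : T2 -> R).
Hypothesis mk : measurable_fun setT (fun z : T1 * T2 => k z.1 z.2).
Hypothesis k_le : forall x y, `|k x y| <= u x * v y.

Lemma pairing_mixturel n (w : 'I_n -> R) (P : 'I_n -> probability T1 R)
    (Q : probability T1 R) (nu : probability T2 R) :
  (forall i, 0 <= w i) -> is_mixture w P Q ->
  (forall i, rintegrable (P i) u) -> rintegrable Q u -> rintegrable nu v ->
  pairing k Q nu = \sum_(i < n) w i * pairing k (P i) nu.
Proof.
move=> w0 QP Pu Qu nuv; rewrite /pairing (Rintegral_mixture w0 QP)//.
  by move=> i; exact: (rintegrable_inner mk k_le (Pu i) nuv).
by apply: rintegrable_measurable; exact: (rintegrable_inner mk k_le Qu nuv).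
Qed.

End pairing_mixtures.

(** Linearity in the first measure, transported to the second one by
    [pairing_swap]. *)
Lemma pairing_mixture d1 d2 (T1 : measurableType d1) (T2 : measurableType d2)
    (R : realType) (k : T1 -> T2 -> R) (u : T1 -> R) (v : T2 -> R)
    n (w : 'I_n -> R) (P : 'I_n -> probability T1 R) (Q : probability T1 R)
    n' (w' : 'I_n' -> R) (P' : 'I_n' -> probability T2 R)
    (Q' : probability T2 R) :
  measurable_fun setT (fun z : T1 * T2 => k z.1 z.2) ->
  (forall x y, `|k x y| <= u x * v y) ->
  (forall i, 0 <= w i) -> is_mixture w P Q ->
  (forall i, 0 <= w' i) -> is_mixture w' P' Q' ->
  measurable_fun setT u -> (forall i, rintegrable (P i) u) ->
  measurable_fun setT v -> (forall i, rintegrable (P' i) v) ->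
  pairing k Q Q' =
  \sum_(i < n) \sum_(j < n') w i * w' j * pairing k (P i) (P' j).
Proof.
move=> mk k_le w0 QP w0' QP' mu Pu mv Pv.
have Qu : rintegrable Q u := rintegrable_mixture w0 QP Pu mu.
have Qv : rintegrable Q' v := rintegrable_mixture w0' QP' Pv mv.
have mk' : measurable_fun setT (fun z : T2 * T1 => k z.2 z.1).
  exact: (measurableT_comp mk (@measurable_swap _ _ T2 T1)).
have k_le' y x : `|k x y| <= v y * u x by rewrite mulrC.
rewrite (pairing_mixturel mk k_le w0 QP)//; apply: eq_bigr => i _.
rewrite (pairing_swap mk k_le)// (pairing_mixturel mk' k_le' w0' QP')//.
rewrite big_distrr/=; apply: eq_bigr => j _.
by rewrite mulrA (pairing_swap mk k_le).
Qed.

Section product_kernels.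
Context d1 d2 (T1 : measurableType d1) (T2 : measurableType d2) (R : realType).
Variables (f : T1 -> T1 -> R) (g : T2 -> T2 -> R) (u : T1 -> R) (v : T2 -> R).
Hypothesis mf : measurable_fun setT (fun z : T1 * T1 => f z.1 z.2).
Hypothesis mg : measurable_fun setT (fun z : T2 * T2 => g z.1 z.2).
Hypothesis f_le : forall x x', `|f x x'| <= u x * u x'.
Hypothesis g_le : forall y y', `|g y y'| <= v y * v y'.

Let F (z1 z2 : T1 * T2) := f z1.1 z2.1 * g z1.2 z2.2.
Let W (z : T1 * T2) := u z.1 * v z.2.

(** With the first variables frozen, [F] is a product of a function on [T1] and
    a function on [T2], so that both integrations factor. *)
Lemma pairing_prod (mu mu' : probability T1 R) (nu nu' : probability T2 R) :
  rintegrable mu u -> rintegrable mu' u ->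
  rintegrable nu v -> rintegrable nu' v ->
  pairing F (mu \x nu)%E (mu' \x nu')%E = pairing f mu mu' * pairing g nu nu'.
Proof.
move=> mui mu'i nui nu'i; rewrite /pairing.
under eq_Rintegral => z _.
  rewrite /F Rintegral_prod; [over| |].
  - exact: (rintegrable_section mf f_le mu'i).
  - exact: (rintegrable_section mg g_le nu'i).
rewrite (@Rintegral_prod _ _ _ _ _ mu nu (fun x => Rintegral mu' setT (f x))
   (fun y => Rintegral nu' setT (g y)))//.
- exact: (rintegrable_inner mf f_le mui mu'i).
- exact: (rintegrable_inner mg g_le nui nu'i).
Qed.

Let mF : measurable_fun setT (fun z : (T1 * T2) * (T1 * T2) => F z.1 z.2).
Proof.
have m1 : measurable_fun setT (fun z : (T1 * T2) * (T1 * T2) => (z.1.1, z.2.1)).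
  by apply: measurable_fun_pair; apply: measurableT_comp.
have m2 : measurable_fun setT (fun z : (T1 * T2) * (T1 * T2) => (z.1.2, z.2.2)).
  by apply: measurable_fun_pair; apply: measurableT_comp.
apply: measurable_funM.
  exact: (measurableT_comp mf m1).
exact: (measurableT_comp mg m2).
Qed.

Let F_le z1 z2 : `|F z1 z2| <= W z1 * W z2.
Proof. by rewrite normrM /W mulrACA ler_pM. Qed.

(** The product measure of a mixture with itself need not be expanded: [F] is
    dominated by [W] in each variable, so its integral is a [pairing], which
    is bilinear. *)
Lemma integral_product_kernel n (w : 'I_n -> R) (mu : 'I_n -> probability T1 R)
    (nu : 'I_n -> probability T2 R) (theta : probability (T1 * T2)%type R) :
  (forall k, 0 <= w k) -> is_mixture w (fun k => (mu k \x nu k)%E) theta ->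
  (forall k, rintegrable (mu k) u) -> (forall k, rintegrable (nu k) v) ->
  measurable_fun setT u -> measurable_fun setT v ->
  (\int[theta \x theta]_z (f z.1.1 z.2.1 * g z.1.2 z.2.2)%:E)%E =
  (\sum_(i < n) \sum_(j < n) w i * w j *
     (pairing f (mu i) (mu j) * pairing g (nu i) (nu j)))%:E.
Proof.
move=> w0 thE ui vi mu_ mv.
have mW : measurable_fun setT W.
  by apply: measurable_funM; apply: measurableT_comp.
have Wi k : rintegrable (mu k \x nu k)%E W by exact: rintegrable_prod.
have Wth : rintegrable theta W by exact: (rintegrable_mixture w0 thE).
rewrite -(EFin_pairing mF F_le Wth Wth); congr (_%:E).
pose P k : probability (T1 * T2)%type R := (mu k \x nu k)%E.
rewrite (@pairing_mixture _ _ _ _ _ F W W _ w P theta _ w P theta)//.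
apply: eq_bigr => i _; apply: eq_bigr => j _; congr (_ * _).
exact: pairing_prod.
Qed.

End product_kernels.

(** * The distance of a separable space is jointly measurable *)

Lemma measurable_fun_ltr d (T : measurableType d) (R : realType) (f : T -> R) :
  (forall r, measurable [set x | f x < r]) -> measurable_fun setT f.
Proof.
move=> fr; apply: (measurability _ (RGenInftyO.measurableE R)).
move=> _ [_ [r ->] <-]; rewrite setTI.
suff -> : f @^-1` `]-oo, r[ = [set x | f x < r] by [].
by apply/seteqP; split => x /=; rewrite in_itv.
Qed.

Section metric_measurability.
Context (R : realType) (X : pointedMetricType R).
Local Notation d := (@mdist R X).

Lemma open_mdist_lt (a : X) (r : R) : open [set x : X | d a x < r].
Proof.
rewrite openE => x /= axr; apply/nbhs_ballP; exists (r - d a x) => /=.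
  by rewrite subr_gt0.
move=> y; rewrite ballEmdist /= ltrBrDl => xyr.
by rewrite (le_lt_trans _ xyr)// metric_triangle.
Qed.

Lemma measurable_mdistr (a : X) : measurable_fun setT (d a : borel X -> R).
Proof.
apply: measurable_fun_ltr => r; apply: sub_sigma_algebra.
exact: open_mdist_lt.
Qed.

Lemma separable_dense_seq : separable_space X ->
  exists a : nat -> X, forall (x : X) (e : R), 0 < e -> exists n, d x (a n) < e.
Proof.
move=> [A cA dA].
have near x e : 0 < e -> exists2 y, A y & d x y < e.
  move=> e0; have [||y [xy Ay]] := dA [set y | d x y < e].
  - by exists x; rewrite /= mdistxx.
  - exact: open_mdist_lt.
  - by exists y.
have /pcard_surjP[a surj_a] := cA.
exists a => x e /(near x)[y Ay xy]; have [n _ an] := surj_a y Ay.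
by exists n; rewrite an.
Qed.

(** For a dense sequence [a], d(x, y) < r if and only if
    d(a n, x) + d(a n, y) < r for some n.  Each of these countably many
    conditions is measurable for the product sigma-algebra, because the
    functions d(a n, -) are. *)
Lemma measurable_mdist : separable_space X ->
  measurable_fun setT (fun z : borel X * borel X => d z.1 z.2).
Proof.
move=> /separable_dense_seq[a near_a]; apply: measurable_fun_ltr => r.
rewrite (_ : [set x | _] =
    \bigcup_n [set z : borel X * borel X | d (a n) z.1 + d (a n) z.2 < r]).
  apply: bigcupT_measurable => n.
  have mdn : measurable_fun setT
      (fun z : borel X * borel X => d (a n) z.1 + d (a n) z.2).
    apply: measurable_funD.
      exact: (measurableT_comp (measurable_mdistr (a n)) measurable_fst).
    exact: (measurableT_comp (measurable_mdistr (a n)) measurable_snd).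
  rewrite -[X in measurable X]setTI.
  rewrite (_ : [set z | _] =
      (fun z : borel X * borel X => d (a n) z.1 + d (a n) z.2) @^-1`
      `]-oo, r[); last first.
    by apply/seteqP; split => z /=; rewrite in_itv.
  exact: mdn.
apply/seteqP; split => [[x y] /= xyr|[x y] [n _] /=].
  have e0 : 0 < (r - d x y) / 2 by rewrite divr_gt0// subr_gt0.
  have [n xan] := near_a x _ e0; exists n => //=.
  have := metric_triangle (a n) x y; rewrite (metric_sym (a n) x).
  lra.
apply: le_lt_trans; rewrite (metric_sym (a n) x); exact: metric_triangle.
Qed.

End metric_measurability.

(** * Integrals against a difference of measures *)

(** The Jordan parts of nu = m1 - m2 are dominated by m1 and m2, so they
    integrate whatever m1 and m2 integrate; and jn + m1 = jp + m2 as measures,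
    which gives the equality of the differences of integrals. *)
Section signed_integrals.
Context d (T : measurableType d) (R : realType).
Variables (nu : {charge set T -> \bar R}).
Variables (m1 m2 : {finite_measure set T -> \bar R}).
Hypothesis nuE : forall A, measurable A -> nu A = (m1 A - m2 A)%E.

Let jp := jordan_pos (hahnP nu).
Let jn := jordan_neg (hahnP nu).

Let jp_le A : measurable A -> (jp A <= m1 A)%E.
Proof.
move=> mA; have [[mP posP] _ _ _] := hahnP nu.
rewrite /jp jordan_posE cjordan_posE /crestr0 mem_set// /crestr.
have mAP : measurable (A `&` hahn_pos nu) by exact: measurableI.
rewrite nuE//; apply: (@le_trans _ _ (m1 (A `&` hahn_pos nu))).
  by rewrite leeBlDr ?fin_num_measure// leeDl.
by rewrite le_measure// ?inE//; exact: subIsetl.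
Qed.

Let jn_le A : measurable A -> (jn A <= m2 A)%E.
Proof.
move=> mA; have [_ [mN negN] _ _] := hahnP nu.
rewrite /jn jordan_negE cjordan_negE /crestr0 mem_set// /crestr.
have mAN : measurable (A `&` hahn_neg nu) by exact: measurableI.
rewrite nuE// fin_num_oppeB ?fin_num_measure//.
apply: (@le_trans _ _ (m2 (A `&` hahn_neg nu))).
  by rewrite addeC leeBlDr ?fin_num_measure// leeDl.
by rewrite le_measure// ?inE//; exact: subIsetl.
Qed.

Let jordan_cancel A : measurable A ->
  measure_add jn m1 A = measure_add jp m2 A.
Proof.
move=> mA; suff : (jn A + m1 A = jp A + m2 A)%E by rewrite !measure_addE.
have : (m1 A - m2 A = jp A - jn A)%E.
  by rewrite -nuE// (jordan_decomp (hahnP nu) mA) /cadd/= cscaleN1.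
have : jp A \is a fin_num by exact: fin_num_measure.
have : jn A \is a fin_num by exact: fin_num_measure.
have : m1 A \is a fin_num by exact: fin_num_measure.
have : m2 A \is a fin_num by exact: fin_num_measure.
case: (m2 A) => // r2 _; case: (m1 A) => // r1 _.
case: (jn A) => // rn _; case: (jp A) => // rp _.
rewrite -!EFinB -!EFinD => -[E]; congr (_%:E); lra.
Qed.

Let rintegrable_sub (m m' : {measure set T -> \bar R}) f :
  (forall A, measurable A -> (m A <= m' A)%E) -> rintegrable m' f ->
  rintegrable m f.
Proof.
move=> mm' /integrableP[mf fy]; apply/integrableP; split=> //.
apply: le_lt_trans fy; apply: ge0_le_measure_integral => //.
exact: measurableT_comp.
Qed.

Lemma signed_RintegralB f : rintegrable m1 f -> rintegrable m2 f ->
  signed_Rintegral nu f = Rintegral m1 setT f - Rintegral m2 setT f.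
Proof.
move=> f1 f2; have fp := rintegrable_sub jp_le f1.
have fn := rintegrable_sub jn_le f2.
have mf := measurable_int _ f1.
have /eqP : (\int[jn]_x (f x)%:E + \int[m1]_x (f x)%:E =
         \int[jp]_x (f x)%:E + \int[m2]_x (f x)%:E)%E.
  rewrite -!integral_measure_add//.
  by apply: eq_measure_integral => A mA _; exact: jordan_cancel.
rewrite -!EFin_Rintegral// -!EFinD eqe => /eqP E.
by rewrite /signed_Rintegral -/jp -/jn; lra.
Qed.

End signed_integrals.

Lemma signed_Rintegral_measure d (T : measurableType d) (R : realType)
    (m : {finite_measure set T -> \bar R}) f : rintegrable m f ->
  signed_Rintegral (charge_of_finite_measure m) f = Rintegral m setT f.
Proof.
move=> fi; rewrite (@signed_RintegralB _ _ _ _ m mzero)//.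
- by rewrite [X in _ - X]/Rintegral integral_measure_zero subr0.
- by move=> A mA; rewrite /mzero sube0.
- apply/integrableP; split; first exact: measurable_int fi.
  by rewrite integral_measure_zero.
Qed.

(** * Energies *)

Section energy.
Context (R : realType) (X : pointedMetricType R).
Hypothesis sepX : separable_space X.
Local Notation d := (@mdist R X : borel X -> borel X -> R).
Implicit Types mu nu : probability (borel X) R.

Definition potential mu (x : X) : R := Rintegral mu setT (d x).
Definition energy mu nu : R := pairing (d : borel X -> borel X -> R) mu nu.
Definition energy_gap mu nu : R :=
  energy mu mu - 2 * energy mu nu + energy nu nu.

(** The constant 1 turns the triangle inequality d(x, y) <= d(o, x) + d(o, y)
    into a bound by a product, see [mdist_le_weight]. *)
Definition weight (o : X) : borel X -> R := fun x => 1 + d o x.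

Lemma measurable_weight o : measurable_fun setT (weight o).
Proof. by apply: measurable_funD => //; exact: measurable_mdistr. Qed.

Lemma mdist_le_weight o x y : `|d x y| <= weight o x * weight o y.
Proof.
rewrite ger0_norm ?mdist_ge0// /weight.
have := metric_triangle x o y; rewrite (metric_sym x o).
have := mdist_ge0 o x; have := mdist_ge0 o y; nra.
Qed.

Lemma rintegrable_mdist mu o : finite_first_moment mu -> rintegrable mu (d o).
Proof.
move=> [p mup]; have pi : rintegrable mu (d p).
  apply/integrableP; split.
    by apply/measurable_EFinP; exact: measurable_mdistr.
  under eq_integral => x _.
    rewrite gee0_abs ?lee_fin ?mdist_ge0//= metric_sym; over.
  exact: mup.
apply: (@rintegrable_le _ _ _ _ _ (fun x => d o p + d p x)).
- exact: measurable_mdistr.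
- move=> x; rewrite !ger0_norm ?addr_ge0 ?mdist_ge0//; exact: metric_triangle.
- rewrite (_ : _ \o _ = (cst (d o p)%:E) \+ (EFin \o d p))%E//.
  by apply: integrableD => //; exact: finite_measure_integrable_cst.
Qed.

Lemma rintegrable_finite_first_moment mu o :
  rintegrable mu (d o) -> finite_first_moment mu.
Proof.
move=> /integrableP[_ muo]; exists o; apply: le_lt_trans muo.
under [leRHS]eq_integral => x _.
  rewrite gee0_abs ?lee_fin ?mdist_ge0//= metric_sym; over.
exact: lexx.
Qed.

Lemma rintegrable_weight mu o :
  finite_first_moment mu -> rintegrable mu (weight o).
Proof.
move=> mu1; rewrite (_ : _ \o _ = (cst 1%:E) \+ (EFin \o d o))%E//.
apply: integrableD => //; first exact: finite_measure_integrable_cst.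
exact: rintegrable_mdist.
Qed.

Lemma finite_first_moment_mixture n (w : 'I_n -> R)
    (P : 'I_n -> probability (borel X) R) mu :
  (forall k, 0 <= w k) -> is_mixture w P mu ->
  (forall k, finite_first_moment (P k)) -> finite_first_moment mu.
Proof.
move=> w0 muE P1; apply: (@rintegrable_finite_first_moment _ point).
apply: (rintegrable_mixture w0 muE); last exact: measurable_mdistr.
by move=> k; exact: rintegrable_mdist.
Qed.

Lemma finite_first_moment_dirac (a : X) :
  finite_first_moment (\d_(a : borel X) : probability (borel X) R).
Proof.
exists a; rewrite integral_dirac// ?diracT ?mul1e ?ltry//.
apply/measurable_EFinP.
rewrite (_ : (fun x => _) = d a); first exact: measurable_mdistr.
by apply/funext => x; rewrite metric_sym.
Qed.

Lemma energyC mu nu : finite_first_moment mu -> finite_first_moment nu ->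
  energy mu nu = energy nu mu.
Proof.
move=> mu1 nu1; rewrite /energy.
rewrite (pairing_swap (measurable_mdist sepX) (mdist_le_weight point)
  (rintegrable_weight _ mu1) (rintegrable_weight _ nu1)).
have dC : (fun y x => d x y) = d.
  by apply/funext => y; apply/funext => x; rewrite metric_sym.
by rewrite dC.
Qed.

Lemma energy_mixture n (w : 'I_n -> R) (P : 'I_n -> probability (borel X) R) mu
    m (v : 'I_m -> R) (Q : 'I_m -> probability (borel X) R) nu :
  (forall k, 0 <= w k) -> is_mixture w P mu ->
  (forall k, finite_first_moment (P k)) ->
  (forall k, 0 <= v k) -> is_mixture v Q nu ->
  (forall k, finite_first_moment (Q k)) ->
  energy mu nu = \sum_(i < n) \sum_(j < m) w i * v j * energy (P i) (Q j).
Proof.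
move=> w0 muE P1 v0 nuE Q1.
apply: (pairing_mixture (measurable_mdist sepX) (mdist_le_weight point) w0 muE
  v0 nuE).
- exact: measurable_weight.
- by move=> i; exact: rintegrable_weight.
- exact: measurable_weight.
- by move=> i; exact: rintegrable_weight.
Qed.

Lemma Rintegral_dirac (a : X) (f : borel X -> R) : measurable_fun setT f ->
  Rintegral (\d_(a : borel X) : probability (borel X) R) setT f = f a.
Proof.
move=> mf; rewrite /Rintegral integral_dirac// ?diracT ?mul1e//.
exact/measurable_EFinP.
Qed.

Lemma energy_dirac (a b : X) :
  energy \d_(a : borel X) \d_(b : borel X) = d a b.
Proof.
rewrite /energy /pairing.
under eq_Rintegral => x _ do rewrite (Rintegral_dirac _ (measurable_mdistr x)).
rewrite Rintegral_dirac//.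
rewrite (_ : (fun x => _) = d b); first exact: measurable_mdistr.
by apply/funext => x; rewrite metric_sym.
Qed.

Lemma rintegrable_potential mu nu :
  finite_first_moment mu -> finite_first_moment nu ->
  rintegrable mu (potential nu : borel X -> R).
Proof.
move=> mu1 nu1; apply: (rintegrable_inner (measurable_mdist sepX)
  (mdist_le_weight point) (rintegrable_weight _ mu1) (rintegrable_weight _ nu1)).
Qed.

Lemma Dmean_charge_sub mu nu :
  finite_first_moment mu -> finite_first_moment nu ->
  Dmean (charge_sub mu nu) = energy_gap mu nu.
Proof.
move=> mu1 nu1.
have subE A : measurable A -> charge_sub mu nu A = (mu A - nu A)%E by [].
rewrite /Dmean (_ : amean _ = (potential mu \- potential nu)); last first.
  apply/funext => x; rewrite /amean (signed_RintegralB subE)//;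
    exact: rintegrable_mdist.
have di rho : finite_first_moment rho ->
    rintegrable rho (potential mu \- potential nu : borel X -> R).
  move=> rho1; rewrite (_ : _ \o _ = (EFin \o (potential mu : borel X -> R)) \-
    (EFin \o (potential nu : borel X -> R)))%E//.
  by apply: integrableB => //; exact: rintegrable_potential.
rewrite (signed_RintegralB subE); [|exact: di|exact: di].
rewrite !RintegralB//; try exact: rintegrable_potential.
rewrite -[LHS]/(energy mu mu - energy mu nu - (energy nu mu - energy nu nu)).
by rewrite (energyC nu1 mu1) /energy_gap; ring.
Qed.

Lemma energy_same mu mu' nu :
  same_measure mu mu' -> energy mu nu = energy mu' nu.
Proof.
move=> mumu'; congr fine; apply: eq_measure_integral => A mA _; exact: mumu'.
Qed.

Lemma energy_gap_same mu nu :
  finite_first_moment mu -> finite_first_moment nu -> same_measure mu nu ->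
  energy_gap mu nu = 0.
Proof.
move=> mu1 nu1 munu; rewrite /energy_gap (energy_same mu munu).
rewrite (energyC mu1 nu1) (energyC nu1 mu1) (energy_same nu munu); ring.
Qed.

End energy.

(** * Distinct measures with zero energy gap *)

Section zero_gap.
Context (R : realType) (X : pointedMetricType R).
Hypothesis sepX : separable_space X.
Local Notation d := (@mdist R X : borel X -> borel X -> R).
Implicit Types mu nu rho : probability (borel X) R.

Definition separating_pair mu nu :=
  [/\ finite_first_moment mu, finite_first_moment nu & ~ same_measure mu nu].

(** The energy gap is the quadratic form of the energy at the difference of the
    two weight vectors. *)
Lemma energy_gap_mixture n (P : 'I_n -> probability (borel X) R)
    (w v : 'I_n -> R) mu nu :
  (forall k, finite_first_moment (P k)) ->
  (forall k, 0 <= w k) -> is_mixture w P mu ->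
  (forall k, 0 <= v k) -> is_mixture v P nu ->
  energy_gap mu nu =
  \sum_(i < n) \sum_(j < n) (w i - v i) * (w j - v j) * energy (P i) (P j).
Proof.
move=> P1 w0 muE v0 nuE; rewrite /energy_gap mulr_natl mulr2n opprD addrA.
rewrite {2}(energyC sepX (finite_first_moment_mixture w0 muE P1)
  (finite_first_moment_mixture v0 nuE P1)).
rewrite (energy_mixture sepX w0 muE P1 w0 muE P1).
rewrite (energy_mixture sepX w0 muE P1 v0 nuE P1).
rewrite (energy_mixture sepX v0 nuE P1 w0 muE P1).
rewrite (energy_mixture sepX v0 nuE P1 v0 nuE P1).
rewrite -!sumrB -big_split/=; apply: eq_bigr => i _.
rewrite -!sumrB -big_split/=; apply: eq_bigr => j _; ring.
Qed.

(** The coefficients sum to zero, hence their positive and negative parts have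
    the same mass c; dividing by c gives two probability measures. *)
Lemma exists_positive_energy_gap : ~ negative_type X ->
  exists mu nu, [/\ finite_first_moment mu, finite_first_moment nu &
    0 < energy_gap mu nu].
Proof.
move=> /existsNP[n /existsNP[x /existsNP[al /not_implyP[al0 /negP]]]].
rewrite -ltNge => Q0.
pose c := \sum_(i < n) Num.max (al i) 0.
have max0 (a : R) : 0 <= Num.max a 0 by rewrite le_max lexx orbT.
have maxB (a : R) : Num.max a 0 - Num.max (- a) 0 = a.
  have [a0|a0] := leP a 0.
    by rewrite max_l ?oppr_ge0// sub0r opprK.
  by rewrite max_r ?subr0// oppr_le0 ltW.
have cE : \sum_(i < n) Num.max (- al i) 0 = c.
  apply/eqP; rewrite eq_sym -subr_eq0 -sumrB -[X in _ == X]al0; apply/eqP.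
  by apply: eq_bigr => i _; exact: maxB.
have c0 : 0 < c.
  rewrite lt_def sumr_ge0 ?andbT//; apply/negP => /eqP c0.
  have al_eq0 i : al i = 0.
    have /psumr_eq0P pos0 := c0; have /psumr_eq0P neg0 := etrans cE c0.
    by rewrite -(maxB (al i)) pos0// neg0// subr0.
  move: Q0; rewrite big1 ?ltxx// => i _; rewrite big1// => j _.
  by rewrite al_eq0 !mul0r.
pose w i := Num.max (al i) 0 / c.
pose v i := Num.max (- al i) 0 / c.
have w0 i : 0 <= w i by rewrite divr_ge0 ?(ltW c0).
have v0 i : 0 <= v i by rewrite divr_ge0 ?(ltW c0).
have w1 : \sum_(i < n) w i = 1 by rewrite -mulr_suml divff ?gt_eqF.
have v1 : \sum_(i < n) v i = 1 by rewrite -mulr_suml cE divff ?gt_eqF.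
pose P i : probability (borel X) R := \d_(x i : borel X).
have P1 i : finite_first_moment (P i) by exact: finite_first_moment_dirac.
have [mu muE] := mixture_exists P w0 w1.
have [nu nuE] := mixture_exists P v0 v1.
exists mu, nu; split.
- exact: (finite_first_moment_mixture w0 muE P1).
- exact: (finite_first_moment_mixture v0 nuE P1).
- rewrite (energy_gap_mixture P1 w0 muE v0 nuE).
  rewrite (_ : \sum_i _ = c^-1 ^+ 2 *
      \sum_(i < n) \sum_(j < n) al i * al j * mdist (x i) (x j)).
    by rewrite mulr_gt0// exprn_gt0// invr_gt0.
  rewrite mulr_sumr; apply: eq_bigr => i _.
  rewrite mulr_sumr; apply: eq_bigr => j _.
  rewrite energy_dirac /w /v -!mulrBl !maxB; ring.
Qed.

Lemma energy_gap_dirac (a b : X) :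
  energy_gap (\d_(a : borel X) : probability (borel X) R)
    (\d_(b : borel X) : probability (borel X) R) = - 2 * d a b.
Proof. by rewrite /energy_gap !energy_dirac !mdistxx; ring. Qed.

Section mix2.
Variables (t : R) (t01 : 0 <= t <= 1).
Variables (mu0 mu1 mu : probability (borel X) R) (muE : is_mix2 t mu0 mu1 mu).
Hypotheses (mu0_1 : finite_first_moment mu0) (mu1_1 : finite_first_moment mu1).

Let w0 i : 0 <= binary (1 - t) t i.
Proof.
by case/andP: t01 => t0 t1; rewrite /binary; case: ifP; rewrite ?subr_ge0.
Qed.

Let P1 i : finite_first_moment (binary mu0 mu1 i).
Proof. by rewrite /binary; case: ifP. Qed.

Lemma finite_first_moment_mix2 : finite_first_moment mu.
Proof. exact: (finite_first_moment_mixture w0 muE P1). Qed.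

Lemma energy_mix2 nu : finite_first_moment nu ->
  energy mu nu = (1 - t) * energy mu0 nu + t * energy mu1 nu.
Proof.
move=> nu1.
rewrite [LHS](pairing_mixturel (measurable_mdist sepX) (mdist_le_weight point)
  w0 muE).
- by rewrite !big_ord_recl big_ord0 addr0.
- by move=> i; exact: rintegrable_weight.
- exact: rintegrable_weight finite_first_moment_mix2.
- exact: rintegrable_weight.
Qed.
End mix2.

(** On the segment from (mu, nu) to (mu', nu') the energy gap is a quadratic
    polynomial in the parameter t, positive at 0 and negative at 1.  If the
    two measures coincided at a root t, then
    (1 - t) (mu - nu) = - t (mu' - nu'), and the quadratic form would give
    (1 - t)^2 A = t^2 C, which is impossible since A > 0 > C. *)
Lemma exists_zero_energy_gap mu nu mu' nu' :
  finite_first_moment mu -> finite_first_moment nu ->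
  finite_first_moment mu' -> finite_first_moment nu' ->
  0 < energy_gap mu nu -> energy_gap mu' nu' < 0 ->
  exists m1 m2, separating_pair m1 m2 /\ energy_gap m1 m2 = 0.
Proof.
move=> mu1 nu1 mu'1 nu'1 A0 C0.
set A := energy_gap mu nu in A0 *; set C := energy_gap mu' nu' in C0 *.
(* [B] is the bilinear form of the energy at mu - nu and mu' - nu'. *)
pose B := energy mu mu' - energy mu nu' - energy nu mu' + energy nu nu'.
pose p : {poly R} :=
  A *: (1 - 'X) ^+ 2 + (2 * B) *: ('X * (1 - 'X)) + C *: 'X ^+ 2.
have pE t : p.[t] = A * (1 - t) ^+ 2 + 2 * B * (t * (1 - t)) + C * t ^+ 2.
  by rewrite /p !hornerE.
have [t t01 /rootP pt0] : exists2 t : R, t \in `[0, 1] & root (- p) t.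
  apply: poly_ivt => //; rewrite !hornerN !pE; apply/andP; split; lra.
have {}t01 : 0 <= t <= 1 by rewrite in_itv in t01.
have {}pt0 : A * (1 - t) ^+ 2 + 2 * B * (t * (1 - t)) + C * t ^+ 2 = 0.
  by move: pt0; rewrite hornerN pE => /eqP; rewrite oppr_eq0 => /eqP.
have [m1 m1E] := mix2_exists mu mu' t01.
have [m2 m2E] := mix2_exists nu nu' t01.
have m1_1 := finite_first_moment_mix2 t01 m1E mu1 mu'1.
have m2_1 := finite_first_moment_mix2 t01 m2E nu1 nu'1.
have e1 k : finite_first_moment k -> _ :=
  energy_mix2 t01 m1E mu1 mu'1 (nu := k).
have e2 k : finite_first_moment k -> _ :=
  energy_mix2 t01 m2E nu1 nu'1 (nu := k).
have sym := energyC sepX.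
have symE := (sym _ _ nu1 mu1, sym _ _ mu'1 mu1, sym _ _ mu'1 nu1,
  sym _ _ nu'1 mu1, sym _ _ nu'1 nu1, sym _ _ nu'1 mu'1).
exists m1, m2; split; first split => //.
- move=> same12.
  have e12 k : energy m1 k = energy m2 k by exact: energy_same.
  have := e12 mu; have := e12 nu; have := e12 mu'; have := e12 nu'.
  rewrite !(e1 _ mu1, e1 _ nu1, e1 _ mu'1, e1 _ nu'1).
  rewrite !(e2 _ mu1, e2 _ nu1, e2 _ mu'1, e2 _ nu'1) !symE => E1 E2 E3 E4.
  (* The equalities of energies against mu - nu and against mu' - nu'. *)
  have AB : (1 - t) * A + t * B = 0.
    rewrite /A /B /energy_gap; move: E3 E4.
    move: (energy mu mu) (energy mu nu) (energy nu nu) => a1 a2 a3.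
    move: (energy mu mu') (energy mu nu') (energy nu mu') (energy nu nu').
    by move=> b1 b2 b3 b4 E3 E4; lra.
  have BC : (1 - t) * B + t * C = 0.
    rewrite /B /C /energy_gap; move: E1 E2.
    move: (energy mu mu') (energy mu nu') (energy nu mu') (energy nu nu').
    move: (energy mu' mu') (energy mu' nu') (energy nu' nu').
    by move=> c1 c2 c3 b1 b2 b3 b4 E1 E2; lra.
  have E : (1 - t) ^+ 2 * A = t ^+ 2 * C.
    transitivity ((1 - t) * ((1 - t) * A + t * B) - t * ((1 - t) * B + t * C)
      + t ^+ 2 * C); first ring.
    by rewrite AB BC !mulr0 subr0 add0r.
  have t0 : t ^+ 2 * C <= 0 by rewrite mulr_ge0_le0 ?sqr_ge0 ?ltW.
  have t1 : 0 <= (1 - t) ^+ 2 * A by rewrite mulr_ge0 ?sqr_ge0 ?ltW.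
  have /eqP : t ^+ 2 * C = 0 by apply/le_anti; rewrite t0 -E t1.
  rewrite mulf_eq0 sqrf_eq0 (lt_eqF C0) orbF => /eqP t_eq0.
  by move: E A0; rewrite t_eq0 subr0 !expr2 !mul0r !mul1r => ->; rewrite ltxx.
- rewrite /energy_gap !(e1 _ m1_1, e1 _ m2_1, e2 _ m2_1).
  rewrite (sym _ _ mu1 m1_1) (sym _ _ mu'1 m1_1) (sym _ _ mu1 m2_1).
  rewrite (sym _ _ mu'1 m2_1) (sym _ _ nu1 m2_1) (sym _ _ nu'1 m2_1).
  rewrite !(e1 _ mu1, e1 _ mu'1, e2 _ mu1, e2 _ mu'1, e2 _ nu1, e2 _ nu'1).
  rewrite !symE.
  rewrite -[RHS]pt0 /A /B /C /energy_gap.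
  move: (energy mu mu) (energy mu nu) (energy nu nu) => a1 a2 a3.
  move: (energy mu mu') (energy mu nu') (energy nu mu') (energy nu nu').
  move: (energy mu' mu') (energy mu' nu') (energy nu' nu').
  by move=> c1 c2 c3 b1 b2 b3 b4; ring.
Qed.

(** The energies against delta_a, which are 0 and d(a, b), tell the two Dirac
    masses apart. *)
Lemma dirac_separating_pair (a b : X) : a <> b ->
  separating_pair \d_(a : borel X) \d_(b : borel X).
Proof.
move=> ab; split; try exact: finite_first_moment_dirac.
move=> same; have dab : 0 < d a b by rewrite mdist_gt0; exact/eqP.
have := energy_same \d_(a : borel X) same.
by rewrite !energy_dirac mdistxx (metric_sym b a) => E; rewrite -E ltxx in dab.
Qed.

Lemma not_strong_negative_type_zero_gap :
  (exists x1 x2 : X, x1 <> x2) -> ~ strong_negative_type X ->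
  exists mu nu, separating_pair mu nu /\ energy_gap mu nu = 0.
Proof.
move=> [a [b ab]] nst.
have [neg|/exists_positive_energy_gap] := pselect (negative_type X).
  have : ~ forall mu nu, finite_first_moment mu -> finite_first_moment nu ->
     (Dmean (charge_sub mu nu) = 0 <-> same_measure mu nu).
    by move=> h; apply: nst; split.
  move=> /existsNP[mu /existsNP[nu /not_implyP[mu1 /not_implyP[nu1]]]].
  rewrite (Dmean_charge_sub sepX mu1 nu1) => gap_same.
  (* Equal measures have zero gap, so the equivalence can only fail for
     distinct measures with zero gap. *)
  have [same|diff] := pselect (same_measure mu nu).
    by case: gap_same; split => // _; exact: energy_gap_same.
  exists mu, nu; split=> //; apply: contrapT => gap0.
  by apply: gap_same; split.
move=> [mu [nu [mu1 nu1 gap0]]].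
apply: (exists_zero_energy_gap mu1 nu1 _ _ gap0).
- exact: (finite_first_moment_dirac a).
- exact: (finite_first_moment_dirac b).
- rewrite energy_gap_dirac mulNr oppr_lt0 mulr_gt0// mdist_gt0; exact/eqP.
Qed.

End zero_gap.

(** * The centered distance *)

Section centered_distance.
Context (R : realType) (X : pointedMetricType R).
Hypothesis sepX : separable_space X.
Local Notation d := (@mdist R X : borel X -> borel X -> R).
Implicit Types mu nu rho : probability (borel X) R.

Lemma potential_ge0 rho x : 0 <= potential rho x.
Proof. by apply: Rintegral_ge0 => y _; exact: mdist_ge0. Qed.

Lemma dcenteredE rho : finite_first_moment rho ->
  dcentered (charge_of_finite_measure rho) =
  (fun x y => d x y - potential rho x - potential rho y + energy rho rho).
Proof.
move=> rho1; apply/funext => x; apply/funext => y.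
have ameanE : amean (charge_of_finite_measure rho) = potential rho.
  apply/funext => z; rewrite /amean signed_Rintegral_measure//.
  exact: rintegrable_mdist.
rewrite /dcentered /Dmean ameanE signed_Rintegral_measure//.
exact: rintegrable_potential.
Qed.

Lemma measurable_dcentered rho : finite_first_moment rho ->
  measurable_fun setT (fun z : borel X * borel X =>
    dcentered (charge_of_finite_measure rho) z.1 z.2).
Proof.
move=> rho1; rewrite dcenteredE//.
have mpot := rintegrable_measurable (rintegrable_potential sepX rho1 rho1).
apply: measurable_funD => //; apply: measurable_funB; last first.
  exact: (measurableT_comp mpot measurable_snd).
apply: measurable_funB; first exact: measurable_mdist.
exact: (measurableT_comp mpot measurable_fst).
Qed.

(** With C the potential at the base point o and D the energy of rho, the
    centered distance is in absolute value at most
    2 d(o, x) + 2 d(o, y) + 2 C + |D|, and K = 2 + 2 C + |D| >= 1 absorbs all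
    the constants into a product. *)
Lemma dcentered_le rho : finite_first_moment rho ->
  exists K : R, forall x y : borel X,
    `|dcentered (charge_of_finite_measure rho) x y| <=
    (K * weight point x) * (K * weight point y).
Proof.
move=> rho1; pose o : borel X := point.
pose C := potential rho o; pose D := energy rho rho.
have C0 : 0 <= C := potential_ge0 rho o.
have pot_le x : potential rho x <= d o x + C.
  have di z := rintegrable_mdist z rho1.
  have ci : rintegrable rho (fun=> d o x) by exact: finite_measure_integrable_cst.
  rewrite -[leLHS]mulr1 /potential.
  have -> : d o x + C = Rintegral rho setT (fun y => d o x + d o y).
    rewrite RintegralD//.
    by rewrite Rintegral_cst// [X in fine X]probability_setT mulr1.
  rewrite mulr1; apply: le_Rintegral => //; first exact: di.
    rewrite (_ : _ \o _ = (cst (d o x)%:E) \+ (EFin \o d o))%E//.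
    by apply: integrableD => //; exact: di.
  by move=> y _; rewrite (metric_sym o x); exact: metric_triangle.
exists (2 + 2 * C + `|D|).
move=> x y; rewrite dcenteredE// -/D /weight -/o.
have := potential_ge0 rho x; have := potential_ge0 rho y.
have := pot_le x; have := pot_le y.
have := metric_triangle x o y; rewrite (metric_sym x o).
have := mdist_ge0 o x; have := mdist_ge0 o y; have := mdist_ge0 x y.
have := normr_ge0 D; have := ler_norm D; have := ler_norm (- D); rewrite normrN.
move: (potential rho x) (potential rho y) (d x y) (d o x) (d o y) (`|D|) C0.
move=> px py xy ox oy N C0 h1 h2 h3 h4 h5 h6 h7 h8 h9 h10 h11.
have hb : `|xy - px - py + D| <= 2 * ox + 2 * oy + 2 * C + N.
  by rewrite ler_norml; apply/andP; split; lra.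
apply: (le_trans hb).
set K := 2 + 2 * C + N.
have K1 : 1 <= K by rewrite /K; lra.
have KK : K <= K * K by rewrite ler_peMr//; lra.
have -> : K * (1 + ox) * (K * (1 + oy)) = K * K * ((1 + ox) * (1 + oy)) by ring.
have w0 : 0 <= (1 + ox) * (1 + oy) by rewrite mulr_ge0; lra.
apply: (le_trans _ (ler_wpM2r w0 KK)).
have : K * (1 + ox + oy) <= K * ((1 + ox) * (1 + oy)).
  by rewrite ler_wpM2l//; [lra|nra].
apply: le_trans; rewrite /K; nra.
Qed.

Lemma pairing_dcentered rho mu nu : finite_first_moment rho ->
  finite_first_moment mu -> finite_first_moment nu ->
  pairing (dcentered (charge_of_finite_measure rho) : borel X -> borel X -> R)
    mu nu =
  energy mu nu - energy mu rho - energy nu rho + energy rho rho.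
Proof.
move=> rho1 mu1 nu1; rewrite dcenteredE//.
have csti (m : probability (borel X) R) (c : R) : rintegrable m (fun=> c).
  exact: finite_measure_integrable_cst.
have subi (m : probability (borel X) R) f g :
    rintegrable m f -> rintegrable m g -> rintegrable m (fun x => f x - g x).
  by move=> fi gi; exact: (@integrableB _ _ _ m _ measurableT _ _ fi gi).
have cstE (m : probability (borel X) R) (c : R) :
    Rintegral m setT (fun=> c) = c.
  by rewrite Rintegral_cst// [X in fine X]probability_setT mulr1.
have poti m := rintegrable_potential sepX (mu := m) (nu := rho).
have RB (m : probability (borel X) R) f g :
    rintegrable m f -> rintegrable m g ->
    Rintegral m setT (fun x => f x - g x) =
    Rintegral m setT f - Rintegral m setT g.
  by move=> fi gi; exact: RintegralB.
have RD (m : probability (borel X) R) f (c : R) : rintegrable m f ->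
    Rintegral m setT (fun x => f x + c) = Rintegral m setT f + c.
  by move=> fi; rewrite RintegralD ?cstE//; exact: csti.
rewrite /pairing.
have inner x : Rintegral nu setT (fun y => d x y - potential rho x -
     potential rho y + energy rho rho) =
   potential nu x - potential rho x - energy nu rho + energy rho rho.
  have h1 := rintegrable_mdist x nu1.
  have h2 := subi _ _ _ h1 (csti nu (potential rho x)).
  have h3 := subi _ _ _ h2 (poti _ nu1 rho1).
  by rewrite (RD _ _ _ h3) (RB _ _ _ h2 (poti _ nu1 rho1)) (RB _ _ _ h1) ?cstE.
under eq_Rintegral => x _ do rewrite inner.
have h1 := poti _ mu1 rho1.
have h1' : rintegrable mu (potential nu : borel X -> R).
  exact: rintegrable_potential.
have h2 := subi _ _ _ h1' h1.
have h3 := subi _ _ _ h2 (csti mu (energy nu rho)).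
by rewrite (RD _ _ _ h3) (RB _ _ _ h2) ?cstE// (RB _ _ _ h1' h1).
Qed.

End centered_distance.

(** * Mixtures of two product measures *)

Section product_mixture.
Context (R : realType) (X Y : pointedMetricType R).
Variables (n : nat) (w : 'I_n -> R).
Variables (mu : 'I_n -> probability (borel X) R).
Variables (nu : 'I_n -> probability (borel Y) R).
Variable theta : probability (borel X * borel Y)%type R.
Hypothesis thetaE : is_mixture w (fun k => (mu k \x nu k)%E) theta.

Lemma marginal1_mixture : is_mixture w mu (marginal1 theta).
Proof.
move=> A mA; rewrite -[LHS]/(theta (fst @^-1` A)).
have -> : fst @^-1` A = A `*` setT :> set (borel X * borel Y).
  by apply/seteqP; split => [z|z []].
rewrite thetaE; last exact: measurableX.
apply: eq_bigr => k _.
rewrite [X in (_ * X)%E](product_measure1E (mu k) (nu k))//.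
by rewrite [X in (_ * (_ * X))%E](probability_setT (nu k)) mule1.
Qed.

Lemma marginal2_mixture : is_mixture w nu (marginal2 theta).
Proof.
move=> A mA; rewrite -[LHS]/(theta (snd @^-1` A)).
have -> : snd @^-1` A = setT `*` A :> set (borel X * borel Y).
  by apply/seteqP; split => [z|z []].
rewrite thetaE; last exact: measurableX.
apply: eq_bigr => k _.
rewrite [X in (_ * X)%E](product_measure1E (mu k) (nu k))//.
by rewrite [X in (_ * (X * _))%E](probability_setT (mu k)) mul1e.
Qed.

End product_mixture.

Section half_mixtures.
Context (R : realType).

Let half01 : 0 <= (2^-1 : R) <= 1.
Proof. by apply/andP; split; lra. Qed.

(** Centering at the midpoint rho makes the double integral of the centered
    distance a bilinear form vanishing on rho; since mu1 - rho = (mu1 - mu2) / 2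
    and mu2 - rho = - (mu1 - mu2) / 2, its values are the energy gap over 4 up
    to sign. *)
Lemma pairing_dcentered_half (X : pointedMetricType R)
    (mu1 mu2 rho : probability (borel X) R)
    (k := dcentered (charge_of_finite_measure rho) : borel X -> borel X -> R) :
  separable_space X -> finite_first_moment mu1 -> finite_first_moment mu2 ->
  is_mix2 2^-1 mu1 mu2 rho ->
  [/\ pairing k mu1 mu1 = energy_gap mu1 mu2 / 4,
      pairing k mu1 mu2 = - (energy_gap mu1 mu2 / 4),
      pairing k mu2 mu1 = - (energy_gap mu1 mu2 / 4) &
      pairing k mu2 mu2 = energy_gap mu1 mu2 / 4].
Proof.
move=> sepX m1 m2 rhoE.
have rho1 := finite_first_moment_mix2 half01 rhoE m1 m2.
have rhol nu : finite_first_moment nu -> _ :=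
  energy_mix2 sepX half01 rhoE m1 m2 (nu := nu).
have e11 : energy mu1 rho = 2^-1 * (energy mu1 mu1 + energy mu1 mu2).
  rewrite energyC// rhol// (energyC sepX m2 m1).
  by move: (energy mu1 mu1) (energy mu1 mu2) => a b; lra.
have e22 : energy mu2 rho = 2^-1 * (energy mu1 mu2 + energy mu2 mu2).
  rewrite energyC// rhol//.
  by move: (energy mu1 mu2) (energy mu2 mu2) => a b; lra.
have err : energy rho rho =
    4^-1 * (energy mu1 mu1 + 2 * energy mu1 mu2 + energy mu2 mu2).
  rewrite rhol// e11 e22.
  by move: (energy mu1 mu1) (energy mu1 mu2) (energy mu2 mu2) => a b c; lra.
by split; rewrite pairing_dcentered// err ?e11 ?e22 /energy_gap
  ?(energyC sepX m2 m1);
  move: (energy mu1 mu1) (energy mu1 mu2) (energy mu2 mu2) => a b c; lra.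
Qed.

(** In each of the four terms the signs given by [pairing_dcentered_half] in the
    two spaces agree, so that every term is 1/4 of the product of the gaps
    over 16. *)
Lemma dcov_half_mixture (X Y : pointedMetricType R)
    (mu1 mu2 : probability (borel X) R) (nu1 nu2 : probability (borel Y) R)
    (theta : probability (borel X * borel Y)%type R) :
  separable_space X -> separable_space Y ->
  finite_first_moment mu1 -> finite_first_moment mu2 ->
  finite_first_moment nu1 -> finite_first_moment nu2 ->
  is_mixture (binary (1 - 2^-1) 2^-1)
    (fun k => (binary mu1 mu2 k \x binary nu1 nu2 k)%E) theta ->
  dcov theta = (energy_gap mu1 mu2 * energy_gap nu1 nu2 / 16)%:E.
Proof.
move=> sepX sepY m1 m2 n1 n2 thE.
have muE : is_mix2 2^-1 mu1 mu2 (marginal1 theta) := marginal1_mixture thE.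
have nuE : is_mix2 2^-1 nu1 nu2 (marginal2 theta) := marginal2_mixture thE.
have mu1' := finite_first_moment_mix2 half01 muE m1 m2.
have nu1' := finite_first_moment_mix2 half01 nuE n1 n2.
have [K f_le] := dcentered_le sepX mu1'.
have [L g_le] := dcentered_le sepY nu1'.
have Pmu k : finite_first_moment (binary mu1 mu2 k).
  by rewrite /binary; case: ifP.
have Pnu k : finite_first_moment (binary nu1 nu2 k).
  by rewrite /binary; case: ifP.
have ui (Z : pointedMetricType R) (c : R) (m : probability (borel Z) R) :
    finite_first_moment m -> rintegrable m (fun z => c * weight point z).
  move=> mm; rewrite (_ : _ \o _ = fun z => c%:E * (weight point z)%:E)%E//.
  by apply: integrableZl => //; exact: rintegrable_weight.
have mw (Z : pointedMetricType R) (c : R) :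
    measurable_fun setT (fun z : borel Z => c * weight point z).
  by apply: measurable_funM => //; exact: measurable_weight.
have w0 i : 0 <= binary (1 - 2^-1) 2^-1 i :> R.
  by case/andP: half01 => ? ?; rewrite /binary; case: ifP; rewrite ?subr_ge0.
rewrite /dcov (integral_product_kernel (measurable_dcentered sepX mu1')
  (measurable_dcentered sepY nu1') f_le g_le w0 thE)//;
  try by move=> k; exact: ui.
have [f11 f12 f21 f22] := pairing_dcentered_half sepX m1 m2 muE.
have [g11 g12 g21 g22] := pairing_dcentered_half sepY n1 n2 nuE.
rewrite !big_ord_recl !big_ord0 /binary /= f11 f12 f21 f22 g11 g12 g21 g22.
by move: (energy_gap mu1 mu2) (energy_gap nu1 nu2) => a b; congr (_%:E); lra.
Qed.

(** On a rectangle A x B, theta minus the product of its marginals is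
    (mu1 A - mu2 A) (nu1 B - nu2 B) / 4; take A and B that tell the measures
    apart. *)
Lemma half_mixture_not_product (X Y : pointedMetricType R)
    (mu1 mu2 : probability (borel X) R) (nu1 nu2 : probability (borel Y) R)
    (theta : probability (borel X * borel Y)%type R) :
  is_mixture (binary (1 - 2^-1) 2^-1)
    (fun k => (binary mu1 mu2 k \x binary nu1 nu2 k)%E) theta ->
  ~ same_measure mu1 mu2 -> ~ same_measure nu1 nu2 ->
  ~ same_measure theta (marginal1 theta \x marginal2 theta)%E.
Proof.
move=> thE /existsNP[A /not_implyP[mA A12]] /existsNP[B /not_implyP[mB B12]].
move=> /(_ (A `*` B) (measurableX mA mB)).
rewrite [X in _ = X -> _]
  (product_measure1E (marginal1 theta) (marginal2 theta))//.
rewrite [X in _ = (X * _)%E -> _](marginal1_mixture thE)//.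
rewrite [X in _ = (_ * X)%E -> _](marginal2_mixture thE)//.
rewrite thE; last exact: measurableX.
rewrite !big_ord_recl !big_ord0 /binary /= !adde0.
have fin d (T : measurableType d) (P : probability T R) E : measurable E ->
  exists r, P E = r%:E.
  by move=> mE; exists (fine (P E)); rewrite fineK// fin_num_measure.
have [a1 a1E] := fin _ _ mu1 _ mA; have [a2 a2E] := fin _ _ mu2 _ mA.
have [b1 b1E] := fin _ _ nu1 _ mB; have [b2 b2E] := fin _ _ nu2 _ mB.
have p1 : (mu1 \x nu1)%E (A `*` B) = (a1 * b1)%:E.
  by rewrite EFinM -a1E -b1E; exact: product_measure1E.
have p2 : (mu2 \x nu2)%E (A `*` B) = (a2 * b2)%:E.
  by rewrite EFinM -a2E -b2E; exact: product_measure1E.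
rewrite [X in (_ * X + _)%E = _ -> _]p1 [X in (_ + _ * X)%E = _ -> _]p2.
rewrite a1E a2E in A12 *; rewrite b1E b2E in B12 *.
rewrite -!EFinM -!EFinD => -[E].
have /eqP : (a1 - a2) * (b1 - b2) = 0 by lra.
rewrite mulf_eq0 !subr_eq0 => /orP[] /eqP E'.
- by apply: A12; rewrite E'.
- by apply: B12; rewrite E'.
Qed.

Lemma exists_dependent_dcov0 (X Y : pointedMetricType R)
    (mu1 mu2 : probability (borel X) R) (nu1 nu2 : probability (borel Y) R) :
  separable_space X -> separable_space Y ->
  separating_pair mu1 mu2 -> separating_pair nu1 nu2 ->
  energy_gap mu1 mu2 * energy_gap nu1 nu2 = 0 ->
  exists theta : probability (borel X * borel Y)%type R,
    [/\ finite_first_moments theta,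
        dcov theta = 0%E &
        ~ same_measure theta (marginal1 theta \x marginal2 theta)%E].
Proof.
move=> sepX sepY [m1 m2 m12] [n1 n2 n12] gap0.
have [theta thE] := mix2_exists (mu1 \x nu1)%E (mu2 \x nu2)%E half01.
have {}thE : is_mixture (binary (1 - 2^-1) 2^-1)
    (fun k => (binary mu1 mu2 k \x binary nu1 nu2 k)%E) theta.
  by move=> A mA; rewrite (thE A mA) !big_ord_recl !big_ord0 /binary.
exists theta; split.
- split.
    exact: (finite_first_moment_mix2 half01 (marginal1_mixture thE)).
  exact: (finite_first_moment_mix2 half01 (marginal2_mixture thE)).
- by rewrite (dcov_half_mixture sepX sepY m1 m2 n1 n2 thE) gap0 mul0r.
- exact: (half_mixture_not_product thE m12 n12).
Qed.

End half_mixtures.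

Theorem theorem3p26 (R : realType) (X Y : pointedMetricType R)
  (sepX : separable_space X) (sepY : separable_space Y)
  (twoX : exists x1 x2 : X, x1 <> x2) (twoY : exists y1 y2 : Y, y1 <> y2)
  (nsnt : ~ strong_negative_type X \/ ~ strong_negative_type Y) :
  exists theta : probability (borel X * borel Y)%type R,
    [/\ finite_first_moments theta,
        dcov theta = 0%E &
        ~ same_measure theta (marginal1 theta \x marginal2 theta)%E].
Proof.
case: nsnt => nst.
- have [mu1 [mu2 [mu12 gap0]]] := not_strong_negative_type_zero_gap sepX twoX nst.
  have [y1 [y2 y12]] := twoY; have nu12 := dirac_separating_pair y12.
  apply: (exists_dependent_dcov0 sepX sepY mu12 nu12).
  by rewrite gap0 mul0r.
- have [nu1 [nu2 [nu12 gap0]]] := not_strong_negative_type_zero_gap sepY twoY nst.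
  have [x1 [x2 x12]] := twoX; have mu12 := dirac_separating_pair x12.
  apply: (exists_dependent_dcov0 sepX sepY mu12 nu12).
  by rewrite gap0 mulr0.
Qed.
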